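(* Let $n$ be a positive integer, and let $G(V,E,w')$ and $G(V,E,w)$ be two weighted graphs on the same underlying graph with $\Delta(G)\ge n$ such that $w'(v)\le w(v)$ for all $v\in V$. Suppose additionally that for every $v\in V_n$, every choice of $n$ distinct vertices $u_1,\dots,u_n\in A(v)$, and every $k\in\mathbb{N}\cup\{0\}$, $$w'(v)\le \frac{w_k(u_1)+\cdots+w_k(u_n)}{n},$$ where $(w_k)_{k\ge0}$ is the iteration of $w$ defined in the context. Then there exists a weight function $\widetilde w:V\to\mathbb{R}_+$ such that $G(V,E,\widetilde w)$ is $n$-convex and $w'(v)\le\widetilde w(v)\le w(v)$ for all $v\in V$.
   Context: All graphs are finite, simple and connected. $\mathbb{R}_+=[0,\infty)$ and $\mathbb{N}=\{1,2,\dots\}$. A weighted graph $G(V,E,w)$ is a graph with vertex set $V$, edge set $E$ and a weight function $w:V\to\mathbb{R}_+$. $\Delta(G)$ is the maximum degree. $V_n$ denotes the set of vertices of degree at least $n$, and $A(v)$ the set of vertices adjacent to $v$. $G(V,E,w)$ is $n$-convex if for every $v\in V_n$ and every choice of $n$ distinct vertices $v_1,\dots,v_n\in A(v)$, $n\cdot w(v)\le w(v_1)+\cdots+w(v_n)$. The iteration of $w$ is the sequence of functions $w_k:V\to\mathbb{R}_+$ defined by $w_0=w$ and, for $k\ge 1$, $w_k(v)=w(v)$ if $v\in V\setminus V_n$, and $$w_k(v)=\min\Big\{w_{k-1}(v),\ \inf_{u_1,\dots,u_n}\frac{w_{k-1}(u_1)+\cdots+w_{k-1}(u_n)}{n}\Big\}\quad\text{if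 } v\in V_n,$$ the infimum being over all choices of $n$ distinct vertices $u_1,\dots,u_n\in A(v)$. *)

(* Defs.v *)
From mathcomp Require Import all_boot all_order all_algebra.
From mathcomp Require Import classical_sets reals.

Set Implicit Arguments.
Unset Strict Implicit.
Unset Printing Implicit Defensive.

Import Order.TTheory GRing.Theory Num.Theory.
Local Open Scope ring_scope.

Record simple_graph := SimpleGraph {
  vertex :> finType;
  adj : rel vertex;
  adj_sym : symmetric adj;
  adj_irr : irreflexive adj;
  adj_connected : forall x y, connect adj x y
}.

Definition nbrs (G : simple_graph) (v : G) : {set G} := [set u | adj v u].

Definition degree (G : simple_graph) (v : G) : nat := #|nbrs v|.

Definition max_degree (G : simple_graph) : nat := (\max_(v : G) degree v)%N.

Definition vertices_deg_ge (G : simple_graph) (n : nat) : {set G} :=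
  [set v | (n <= degree v)%N].

(* The choice is ordered; the averages below do not depend on the order. *)
Definition nbr_choice (G : simple_graph) (n : nat) (v : G) (u : n.-tuple G) : Prop :=
  uniq u /\ forall i : 'I_n, tnth u i \in nbrs v.

Definition weight_fun (R : realType) (G : simple_graph) (w : G -> R) : Prop :=
  forall v, 0 <= w v.

Definition n_convex (R : realType) (G : simple_graph) (n : nat) (w : G -> R) : Prop :=
  forall v : G, v \in vertices_deg_ge G n ->
  forall u : n.-tuple G, nbr_choice v u ->
  n%:R * w v <= \sum_(i < n) w (tnth u i).

Definition average (R : realType) (G : simple_graph) (n : nat) (w : G -> R)
    (u : n.-tuple G) : R :=
  (\sum_(i < n) w (tnth u i)) / n%:R.

(* For 0 < n and v of degree at least n the set under inf is finite and
   nonempty, so the conventional value of inf on other sets is never used. *)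
Fixpoint iteration (R : realType) (G : simple_graph) (n : nat) (w : G -> R)
    (k : nat) : G -> R :=
  if k is k'.+1 then fun v =>
    if v \in vertices_deg_ge G n then
      Num.min (iteration n w k' v)
        (inf [set average (iteration n w k') u | u in @nbr_choice G n v]%classic)
    else w v
  else w.

(* Main.v *)
Require Import Defs.
From mathcomp Require Import all_boot all_order all_algebra.
From mathcomp Require Import classical_sets reals.

Set Implicit Arguments.
Unset Strict Implicit.
Unset Printing Implicit Defensive.

Import Order.TTheory GRing.Theory Num.Theory.
Local Open Scope ring_scope.

(** The required weight is the pointwise limit of the iteration, that is
    [wt v = inf_k w_k v], the iterates being nonincreasing in [k].

    The function [w'] stays below every iterate: it is below [w], and the
    hypothesis on averages is what carries this bound through each infimum
    ([iteration_ge]).  Hence the limit exists and lies between [w'] and [w].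
    It is [n]-convex because one step of the iteration gives
    [w_(k+1) v <= average w_k u] ([iteration_le_average]), and this inequality
    passes to the limit: the vertex set being finite, a single index [k] brings
    [w_k] within any given [e > 0] of the limit at all vertices at once
    ([unif_approx_limit]). *)

(** The infimum of an empty set of averages would be [0], which need not be
    above [w']; this lemma rules that case out at vertices of high degree. *)
Lemma nbr_choice_exists (G : simple_graph) (n : nat) (v : G) :
  v \in vertices_deg_ge G n -> exists u : n.-tuple G, nbr_choice v u.
Proof.
rewrite inE => le_n_deg.
have size_take_enum : size (take n (enum (nbrs v))) == n.
  by rewrite size_takel // -cardE.
exists (Tuple size_take_enum); split; first by rewrite take_uniq // enum_uniq.
move=> i; rewrite -mem_enum; apply: (@mem_take n).
exact: (mem_tnth i (Tuple size_take_enum)).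
Qed.

Lemma iteration_nonincr (R : realType) (G : simple_graph) (n : nat) (w : G -> R)
  (v : G) (j k : nat) : (j <= k)%N -> iteration n w k v <= iteration n w j v.
Proof.
have step i : iteration n w i.+1 v <= iteration n w i v.
  case v_deg: (v \in vertices_deg_ge G n); last by case: i => [|i]; rewrite /= v_deg.
  by rewrite [leLHS]/= v_deg ge_min lexx.
move=> /subnK <-; elim: (k - j)%N => // m; exact: le_trans (step _).
Qed.

Section BoundedIteration.

Variables (R : realType) (G : simple_graph) (n : nat) (w' w : G -> R).
Hypothesis w'_le_w : forall v, w' v <= w v.
Hypothesis w'_le_average : forall v : G, v \in vertices_deg_ge G n ->
  forall u : n.-tuple G, nbr_choice v u ->
  forall k : nat, w' v <= average (iteration n w k) u.

Lemma iteration_ge k v : w' v <= iteration n w k v.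
Proof.
elim: k v => [|k IHk] v //=; case: ifP => // v_deg.
rewrite le_min IHk /=; apply: lb_le_inf.
  have [u u_choice] := nbr_choice_exists v_deg.
  by exists (average (iteration n w k) u); exists u.
by move=> _ [u u_choice <-]; apply: w'_le_average.
Qed.

(** The infimum is a lower bound only of sets bounded below, and here the bound
    is supplied by [w']. *)
Lemma iteration_le_average k v (u : n.-tuple G) :
  v \in vertices_deg_ge G n -> nbr_choice v u ->
  iteration n w k.+1 v <= average (iteration n w k) u.
Proof.
move=> v_deg u_choice; rewrite /= v_deg ge_min; apply/orP; right.
apply: ge_inf; last by exists u.
by exists (w' v) => _ [t t_choice <-]; apply: w'_le_average.
Qed.

Definition limit_weight (v : G) : R := inf (range (fun k => iteration n w k v)).

Lemma has_inf_iteration v : has_inf (range (fun k => iteration n w k v)).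
Proof.
split; first by exists (w v); exists 0%N.
by exists (w' v) => _ [k _ <-]; apply: iteration_ge.
Qed.

Lemma limit_weight_le k v : limit_weight v <= iteration n w k v.
Proof. by apply: ge_inf; [case: (has_inf_iteration v) | exists k]. Qed.

Lemma limit_weight_ge v : w' v <= limit_weight v.
Proof.
apply: lb_le_inf; first by case: (has_inf_iteration v).
by move=> _ [k _ <-]; apply: iteration_ge.
Qed.

(** Each vertex has its own good index; as the iterates are nonincreasing, the
    largest of these finitely many indices is good everywhere. *)
Lemma unif_approx_limit (e : R) : 0 < e ->
  exists k, forall v, iteration n w k v <= limit_weight v + e.
Proof.
move=> e_gt0.
have approx v : exists k, iteration n w k v <= limit_weight v + e.
  have [_ [k _ <-] /ltW le_e] := inf_adherent e_gt0 (has_inf_iteration v).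
  by exists k.
pose index v := ex_minn (approx v).
exists (\max_v index v)%N => v.
apply: (@le_trans _ _ (iteration n w (index v) v)).
  exact/iteration_nonincr/leq_bigmax.
by rewrite /index; case: ex_minnP.
Qed.

Lemma limit_weight_n_convex : (0 < n)%N -> n_convex n limit_weight.
Proof.
move=> n_gt0 v v_deg u u_choice.
have nR_gt0 : 0 < n%:R :> R by rewrite ltr0n.
rewrite mulrC -ler_pdivlMr //; apply/ler_addgt0Pr => e e_gt0.
have [k near_limit] := unif_approx_limit e_gt0.
apply: le_trans (limit_weight_le k.+1 v) _.
apply: le_trans (iteration_le_average k v_deg u_choice) _.
rewrite ler_pdivrMr // mulrDl divfK ?gt_eqF //.
apply: le_trans (ler_sum _ (fun i _ => near_limit (tnth u i))) _.
by rewrite big_split /= sumr_const card_ord mulr_natr.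
Qed.

End BoundedIteration.

Theorem corollary1p6 (R : realType) (n : nat) (G : simple_graph) (w' w : G -> R)
  (n_gt0 : (0 < n)%N)
  (w'_weight : weight_fun w') (w_weight : weight_fun w)
  (max_degree_ge : (n <= max_degree G)%N)
  (w'_le_w : forall v : G, w' v <= w v)
  (w'_le_iteration : forall v : G, v \in vertices_deg_ge G n ->
     forall u : n.-tuple G, nbr_choice v u ->
     forall k : nat, w' v <= average (iteration n w k) u) :
  exists wt : G -> R,
    [/\ weight_fun wt, n_convex n wt & forall v : G, w' v <= wt v <= w v].
Proof.
have w'_le_limit := limit_weight_ge w'_le_w w'_le_iteration.
exists (limit_weight n w); split.
- by move=> v; apply: le_trans (w'_weight v) (w'_le_limit v).
- exact: limit_weight_n_convex w'_le_w w'_le_iteration n_gt0.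
- by move=> v; rewrite w'_le_limit (limit_weight_le w'_le_w w'_le_iteration 0 v).
Qed.
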